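(* Let $\mathcal{A}$ be a Lie conformal algebra, let $V$ be a generalized conformal module over $\mathcal{A}$ with action $(a,v)\mapsto a_\lambda v$, and let $q(\partial)\in\mathbb{C}[\partial]$. Define $$\overline{a_\lambda v}:=e^{q(\lambda+\partial)-q(\partial)}\,a_\lambda v\qquad\text{for all } a\in\mathcal{A},\ v\in V.$$ Then $V$ (with the same $\mathbb{C}[\partial]$-module structure) is a generalized conformal module over $\mathcal{A}$ with the new action $(a,v)\mapsto\overline{a_\lambda v}$. Denote this generalized conformal module by $V_{q(\partial)}$. Moreover, $V_{q(\partial)}$ is irreducible if and only if $V$ is irreducible.
   Context: A Lie conformal algebra $\mathcal{A}$ is a $\mathbb{C}[\partial]$-module with a $\mathbb{C}$-bilinear map $\mathcal{A}\times\mathcal{A}\to\mathcal{A}[\lambda]$, $(a,b)\mapsto[a_\lambda b]$, such that $[\partial a_\lambda b]=-\lambda[a_\lambda b]$, $[a_\lambda\partial b]=(\partial+\lambda)[a_\lambda b]$, $[a_\lambda b]=-[b_{-\lambda-\partial}a]$ and $[a_\lambda[b_\mu c]]=[[a_\lambda b]_{\lambda+\mu}c]+[b_\mu[a_\lambda c]]$. A generalized conformal module $V$ over $\mathcal{A}$ is a $\mathbb{C}[\partial]$-module with a $\mathbb{C}$-bilinear map $\mathcal{A}\times V\to V[[\lambda]]$, $(a,v)\mapsto a_\lambda v$, such that for all $a,b\in\mathcal{A}$, $v\in V$: $(\partial a)_\lambda v=-\lambda a_\lambda v$, $a_\lambda(\partial v)=(\partial+\lambda)a_\lambda v$, and $a_\lambda(b_\mu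 v)-b_\mu(a_\lambda v)=[a_\lambda b]_{\lambda+\mu}v$ in $V[[\lambda,\mu]]$ (the action is extended coefficientwise to power series). A submodule is a $\mathbb{C}[\partial]$-submodule $W\subseteq V$ with $a_\lambda w\in W[[\lambda]]$ for all $a\in\mathcal{A}$, $w\in W$; $V$ is irreducible if $V\ne0$ and its only submodules are $0$ and $V$. Here $e^{q(\lambda+\partial)-q(\partial)}=\sum_{k\ge0}\frac{(q(\lambda+\partial)-q(\partial))^k}{k!}$, a well-defined element of $\mathbb{C}[\partial][[\lambda]]$ because $q(\lambda+\partial)-q(\partial)$ is divisible by $\lambda$; $\mathbb{C}[\partial][[\lambda]]$ acts on $V[[\lambda]]$ in the natural way. *)

(* Defs.v *)
From HB Require Import structures.
From mathcomp Require Import all_boot all_order all_algebra.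
From mathcomp Require Import finmap.
From mathcomp Require Import classical_sets reals.
From mathcomp Require Import complex.

Set Implicit Arguments.
Unset Strict Implicit.
Unset Printing Implicit Defensive.

Import GRing.Theory.
Local Open Scope ring_scope.

(* A module over K[∂] is an [lmodType {poly K}]: ∂ acts as ['X *: _] and a
   scalar c of K acts as [c%:P *: _].
   An element of V[[λ]] is the sequence [nat -> V] of its coefficients (of λ^n,
   without divided powers), an element of V[[λ,μ]] is a [nat -> nat -> V] (the
   value at m, n is the coefficient of λ^m μ^n), and an element of A[λ] is a
   finitely supported sequence [{fsfun nat -> A with 0}].
   K[∂][λ] is [{poly {poly K}}], with λ as outer variable. *)

Definition lam {K : numFieldType} : {poly {poly K}} := 'X.
Definition del {K : numFieldType} : {poly {poly K}} := ('X : {poly K})%:P.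

(* The action of K[∂][[λ]] on V[[λ]] (Cauchy product). *)
Definition psmul (K : numFieldType) (V : lmodType {poly K})
    (E : nat -> {poly K}) (f : nat -> V) : nat -> V :=
  fun n => \sum_(i < n.+1) E i *: f (n - i)%N.

Definition pmul (K : numFieldType) (V : lmodType {poly K})
    (P : {poly {poly K}}) (f : nat -> V) : nat -> V :=
  psmul (fun i => P`_i) f.

(* f(λ) |-> f(λ+μ) *)
Definition shift2 (V : zmodType) (f : nat -> V) : nat -> nat -> V :=
  fun m n => f (m + n)%N *+ 'C(m + n, m).

(* [a_λ b]_{λ+μ} v = \sum_k λ^k (c_k)_{λ+μ} v, where [a_λ b] = \sum_k λ^k c_k *)
Definition act_shift (A V : zmodType) (act : A -> V -> nat -> V)
    (c : nat -> A) (v : V) : nat -> nat -> V :=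
  fun m n => \sum_(k < m.+1) shift2 (act (c k) v) (m - k)%N n.

Record lie_conformal_algebra (K : numFieldType) (A : lmodType {poly K})
    (br : A -> A -> {fsfun nat -> A with 0}) : Prop := LieConformalAlgebra {
  br_linearl : forall (c : K) (a a' b : A) (n : nat),
    br (c%:P *: a + a') b n = c%:P *: br a b n + br a' b n;
  br_linearr : forall (c : K) (a b b' : A) (n : nat),
    br a (c%:P *: b + b') n = c%:P *: br a b n + br a b' n;
  br_dell : forall a b : A, br ('X *: a) b =1 pmul (- lam) (br a b);
  br_delr : forall a b : A, br a ('X *: b) =1 pmul (del + lam) (br a b);
  (* [b_{-λ-∂} a] = \sum_k (-λ-∂)^k c_k, where [b_λ a] = \sum_k λ^k c_k *)
  br_skew : forall (a b : A) (n : nat),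
    br a b n = - \sum_(k <- finsupp (br b a)) ((- lam - del) ^+ k)`_n *: br b a k;
  br_jacobi : forall (a b c : A) (m n : nat),
    br a (br b c n) m = act_shift br (br a b) c m n + br b (br a c m) n
}.

Record gen_conformal_module (K : numFieldType) (A : lmodType {poly K})
    (br : A -> A -> {fsfun nat -> A with 0}) (V : lmodType {poly K})
    (act : A -> V -> nat -> V) : Prop := GenConformalModule {
  act_linearl : forall (c : K) (a a' : A) (v : V) (n : nat),
    act (c%:P *: a + a') v n = c%:P *: act a v n + act a' v n;
  act_linearr : forall (c : K) (a : A) (v v' : V) (n : nat),
    act a (c%:P *: v + v') n = c%:P *: act a v n + act a v' n;
  act_dell : forall (a : A) (v : V), act ('X *: a) v =1 pmul (- lam) (act a v);
  act_delr : forall (a : A) (v : V), act a ('X *: v) =1 pmul (del + lam) (act a v);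
  act_comm : forall (a b : A) (v : V) (m n : nat),
    act a (act b v n) m - act b (act a v m) n = act_shift act (br a b) v m n
}.

Record submodule (K : numFieldType) (A V : lmodType {poly K})
    (act : A -> V -> nat -> V) (W : set V) : Prop := Submodule {
  sub_zero : W 0;
  sub_linear : forall (p : {poly K}) (v w : V), W v -> W w -> W (p *: v + w);
  sub_act : forall (a : A) (w : V) (n : nat), W w -> W (act a w n)
}.

Definition irreducible (K : numFieldType) (A V : lmodType {poly K})
    (act : A -> V -> nat -> V) : Prop :=
  (exists v : V, v != 0) /\
  forall W : set V, submodule act W -> W = [set 0]%classic \/ W = [set: V]%classic.

(* q(λ+∂) - q(∂) *)
Definition qdiff (K : numFieldType) (q : {poly K}) : {poly {poly K}} :=
  map_poly polyC q \Po (lam + del) - q%:P.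

(* The exponential series of D in K[∂][λ] with zero constant term: D^k is
   divisible by λ^k, so the terms with k > n do not contribute to the
   coefficient of λ^n (see [pexp_stable]). *)
Definition pexp (K : numFieldType) (D : {poly {poly K}}) : nat -> {poly K} :=
  fun n => \sum_(k < n.+1) (k`!%:R^-1 : K) *: (D ^+ k)`_n.

Definition twist (K : numFieldType) (A V : lmodType {poly K}) (q : {poly K})
    (act : A -> V -> nat -> V) : A -> V -> nat -> V :=
  fun a v => psmul (pexp (qdiff q)) (act a v).

Lemma qdiff_coef0 (K : numFieldType) (q : {poly K}) : (qdiff q)`_0 = 0.
Proof.
rewrite -horner_coef0 /qdiff hornerD hornerN hornerC horner_comp.
rewrite hornerD hornerX hornerC add0r.
by rewrite -[_.['X]]/(q \Po 'X) comp_polyXr subrr.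
Qed.

Lemma coef_expr_small (R : comNzRingType) (D : {poly R}) (k n : nat) :
  D`_0 = 0 -> (n < k)%N -> (D ^+ k)`_n = 0.
Proof.
move=> D0; elim: k n => [//|k IHk] n ltnk.
rewrite exprS coefM big1 // => -[[|i] /= lti] _; first by rewrite D0 mul0r.
rewrite IHk ?mulr0 //; apply: leq_trans (ltnSE ltnk).
by rewrite ltn_subrL (leq_trans _ (ltnSE lti)).
Qed.

Lemma pexp_stable (K : numFieldType) (q : {poly K}) (n N : nat) : (n < N)%N ->
  pexp (qdiff q) n = \sum_(k < N) (k`!%:R^-1 : K) *: (qdiff q ^+ k)`_n.
Proof.
move=> ltnN; rewrite /pexp.
rewrite (big_ord_widen N (fun k => (k`!%:R^-1 : K) *: (qdiff q ^+ k)`_n)) //.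
rewrite big_mkcond; apply: eq_bigr => k _; case: ifP => // /negbT.
rewrite -leqNgt => ltnk.
by rewrite coef_expr_small ?scaler0 // qdiff_coef0.
Qed.

(* Main.v *)
Require Import Defs.
From mathcomp Require Import all_boot all_order all_algebra.
From mathcomp Require Import finmap.
From mathcomp Require Import classical_sets reals.
From mathcomp Require Import complex.
From mathcomp Require Import zify.

(* Write E(λ) = e^{q(λ+∂)-q(∂)}. Since a_λ p(∂) = p(∂+λ) a_λ, the twisted product
   of a_λ and b_μ is E(λ) e^{q(λ+μ+∂)-q(λ+∂)} a_λ b_μ = E(λ+μ) a_λ b_μ. The factor
   E(λ+μ) is symmetric in λ and μ, so it comes out of the commutator and twists
   [a_λ b]_{λ+μ}. As E(0) = 1, the coefficients of the two actions determine each
   other triangularly over K[∂], hence both have the same submodules. *)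

Set Implicit Arguments.
Unset Strict Implicit.
Unset Printing Implicit Defensive.
Import GRing.Theory Num.Theory.
Local Open Scope ring_scope.

(* p(∂+λ) as a series in λ *)
Local Notation taylor p := (fun n => p^`N(n)).

(** * Reindexing and binomial identities *)

Lemma exchange_triangle (V : nmodType) (n : nat) (F : nat -> nat -> V) :
  \sum_(i < n.+1) \sum_(j < (n - i).+1) F i j =
  \sum_(j < n.+1) \sum_(i < (n - j).+1) F i j.
Proof.
(* Both double sums run over the pairs with [i + j <= n]. *)
have widen (G : nat -> V) (i : 'I_n.+1) :
    \sum_(j < (n - i).+1) G j = \sum_(j < n.+1 | (i + j <= n)%N) G j.
  rewrite (big_ord_widen n.+1 G) ?ltnS ?leq_subr //.
  by apply: eq_bigl => j; rewrite ltnS leq_subRL // -ltnS.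
under eq_bigr do rewrite widen.
rewrite (exchange_big_dep xpredT) //=; apply: eq_bigr => j _.
by rewrite (widen (F^~ j)); apply: eq_bigl => i; rewrite addnC.
Qed.

Lemma shift2C (V : zmodType) (f : nat -> V) (m n : nat) :
  shift2 f m n = shift2 f n m.
Proof. by rewrite /shift2 addnC -bin_sub ?leq_addl // addnK. Qed.

(** Both sides are the coefficient of λ^l μ^j in p(∂+λ+μ). *)
Lemma shift2_nderivn (K : numFieldType) (p : {poly K}) (l j : nat) :
  p^`N(j)^`N(l) = shift2 (taylor p) l j.
Proof.
apply/polyP => i; rewrite /shift2 coefMn !coef_nderivn -!mulrnA addnCA addnA.
congr (_ *+ _); apply/eqP.
(* Multiplied by i! j! l!, both products of binomials become (l+j+i)!. *)
rewrite -(eqn_pmul2r (fact_gt0 i)) -(eqn_pmul2r (fact_gt0 j)).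
rewrite -(eqn_pmul2r (fact_gt0 l)).
apply/eqP; transitivity ((l + j + i)`!)%N.
  have := bin_fact (leq_addr i l); have := bin_fact (leq_addr (l + i) j).
  rewrite !addKn addnCA addnA => <- <-; lia.
have := bin_fact (leq_addr i (l + j)); have := bin_fact (leq_addr j l).
rewrite !addKn => <- <-; lia.
Qed.

(** * Cauchy products, Taylor expansion and the shift to λ+μ *)

Section PowerSeries.

Variables (K : numFieldType) (V : lmodType {poly K}).
Implicit Types (E F : nat -> {poly K}) (f g : nat -> V).

Lemma eq_psmul E F f g : E =1 F -> f =1 g -> psmul E f =1 psmul F g.
Proof. by move=> eqE eqf n; apply: eq_bigr => i _; rewrite eqE eqf. Qed.

Lemma psmul_linear E (c : {poly K}) f g (n : nat) :
  psmul E (fun i => c *: f i + g i) n = c *: psmul E f n + psmul E g n.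
Proof.
rewrite /psmul scaler_sumr -big_split; apply: eq_bigr => i _.
by rewrite scalerDr !scalerA mulrC.
Qed.

Lemma psmul_sum E (I : Type) (r : seq I) (f : I -> nat -> V) (n : nat) :
  psmul E (fun m => \sum_(i <- r) f i m) n = \sum_(i <- r) psmul E (f i) n.
Proof.
by rewrite /psmul exchange_big; apply: eq_bigr => i _; rewrite scaler_sumr.
Qed.

(** Both sides sum over the triples with i + j + k = n. The type [{poly K}^o] views K[∂] as a module
    over itself, so that [psmul] also multiplies two scalar series. *)
Lemma psmulA E F f :
  psmul E (psmul F f) =1 psmul (psmul E (F : nat -> {poly K}^o)) f.
Proof.
move=> n; transitivity (\sum_(i < n.+1) \sum_(j < (n - i).+1)
    (E i * F j) *: f (n - i - j)%N).
  by apply: eq_bigr => i _; rewrite scaler_sumr; under eq_bigr do rewrite scalerA.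
rewrite /psmul; under [RHS]eq_bigr do rewrite scaler_suml.
have rv (m : nat) (G : nat -> V) : \sum_(i < m.+1) G i = \sum_(i < m.+1) G (m - i)%N.
  by rewrite (reindex_inj rev_ord_inj); apply: eq_bigr => i _; rewrite /= subSS.
(* Reversing the outer sum gives the right side the shape required by [exchange_triangle]. *)
rewrite [RHS](rv n (fun k => \sum_(i < k.+1) (E i * F (k - i)%N) *: f (n - k)%N)).
rewrite -(exchange_triangle n (fun i k => (E i * F (n - k - i)%N) *: f (n - (n - k))%N)).
apply: eq_bigr => i _.
rewrite (rv _ (fun j => (E i * F j) *: f (n - i - j)%N)).
apply: eq_bigr => k _.
have lek : (k <= n - i)%N by rewrite -ltnS.
by rewrite subKn // subnAC subKn // (leq_trans lek) ?leq_subr.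
Qed.

End PowerSeries.

Lemma psmulC (K : numFieldType) (E F : nat -> {poly K}^o) :
  psmul E F =1 psmul F E.
Proof.
move=> n; rewrite /psmul (reindex_inj rev_ord_inj); apply: eq_bigr => i _ /=.
by rewrite subSS subKn -1?ltnS // /GRing.scale /= mulrC.
Qed.

Lemma psmulCA (K : numFieldType) (V : lmodType {poly K})
    (E F : nat -> {poly K}) (f : nat -> V) :
  psmul E (psmul F f) =1 psmul F (psmul E f).
Proof. by move=> n; rewrite !psmulA; apply: eq_psmul => // ?; apply: psmulC. Qed.

Lemma psmulDdl (K : numFieldType) (V : lmodType {poly K}) (f : nat -> V) (n : nat) :
  pmul (del + lam) f n = 'X *: f n + (if n is m.+1 then f m else 0).
Proof.
rewrite /pmul /psmul big_ord_recl subn0 coefD coefC coefX addr0; congr (_ + _).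
case: n => [|n]; first by rewrite big_ord0.
rewrite big_ord_recl big1 => [|i _]; last by rewrite coefD coefC coefX addr0 scale0r.
by rewrite /= coefD coefC coefX add0r scale1r addr0 subSS subn0.
Qed.

(* T(λ) p(∂) = p(∂+λ) T(λ), whose λ^n-coefficient is given by Taylor's formula. *)
Lemma psmul_taylor (K : numFieldType) (V W : lmodType {poly K}) (T : V -> nat -> W) :
  (forall (c : K) v w n, T (c%:P *: v + w) n = c%:P *: T v n + T w n) ->
  (forall v, T ('X *: v) =1 pmul (del + lam) (T v)) ->
  forall (p : {poly K}) v, T (p *: v) =1 psmul (taylor p) (T v).
Proof.
move=> Tlin Tdel p v.
elim/poly_ind: p => [|p c IHp] n.
  have T0 m : T 0 m = 0.
    have := Tlin (-1) 0 0 m; rewrite polyCN scaleN1r scaleN1r oppr0 addr0 addNr.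
    exact.
  by rewrite scale0r T0 /psmul big1 // => i _; rewrite linear0 scale0r.
rewrite -mulrC scalerDl -scalerA addrC Tlin Tdel psmulDdl IHp.
rewrite /psmul !big_ord_recl !nderivn0 !subn0 scalerDl -scalerA scalerDr.
rewrite scaler_sumr.
(* With p_i the Taylor coefficients of p, those of p∂ + c in degree i+1 are ∂ p_(i+1) + p_i: the
   first terms give ∂ T(p v), the shifted ones λ T(p v). *)
under [X in _ = _ + X]eq_bigr do rewrite mulrC nderivnMXaddC scalerDl -mulrC -scalerA.
rewrite big_split /= [X in _ = _ + X]addrC addrA addrCA !addrA; congr (_ + _).
case: n => [|n]; first by rewrite big_ord0.
by rewrite IHp; apply: eq_bigr.
Qed.

(** The Leibniz rule is the case of [psmul_taylor] where T sends r to r(∂+λ). *)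
Lemma nderivnM (K : numFieldType) (p q : {poly K}) (n : nat) :
  (p * q)^`N(n) =
  psmul (taylor p) (taylor q : nat -> {poly K}^o) n.
Proof.
apply: (@psmul_taylor K {poly K}^o {poly K}^o (fun r m => r^`N(m))).
  by move=> c r s m; rewrite nderivnD /GRing.scale /= !mul_polyC nderivnZ.
move=> r m; rewrite psmulDdl /GRing.scale /= mulrC -[r * 'X]addr0.
case: m => [|m]; first by rewrite !nderivn0 !addr0 mulrC.
by rewrite -polyC0 nderivnMXaddC addrC mulrC.
Qed.

(* E(λ) acting on f(λ), both moved to λ+μ: by Vandermonde's convolution this is
   the bivariate Cauchy product of E(λ+μ) and f(λ+μ). *)
Lemma shift2_psmul (K : numFieldType) (V : lmodType {poly K})
    (E : nat -> {poly K}) (f : nat -> V) (m n : nat) :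
  shift2 (psmul E f) m n =
  \sum_(j < n.+1) psmul ((shift2 E)^~ j) (fun i => shift2 f i (n - j)%N) m.
Proof.
rewrite /shift2 /psmul -sumrMnl.
(* The index [l] counts the factors λ taken from (λ+μ)^i; the other [m - l] come from
   (λ+μ)^(m+n-i). *)
transitivity (\sum_(i < (m + n).+1) \sum_(l < m.+1)
   (E i *: f (m + n - i)%N) *+ ('C(i, l) * 'C(m + n - i, m - l))).
  apply: eq_bigr => i _; rewrite sumrMnr binomial.Vandermonde subnKC //.
  by rewrite -ltnS.
rewrite exchange_big [RHS]exchange_big; apply: eq_bigr => l _ /=.
have lel : (l <= m)%N by rewrite -ltnS.
set G := fun i => (E i *: f (m + n - i)%N) *+ ('C(i, l) * 'C(m + n - i, m - l)).
(* Only l <= i <= l + n contributes: one of the two binomials vanishes outside this range. *)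
rewrite -(big_mkord xpredT G) (@big_cat_nat _ _ _ l) //=; last first.
  by rewrite (leq_trans lel) // leqW ?leq_addr.
rewrite [X in _ + X](@big_cat_nat _ _ _ (l + n.+1)) /=; last 2 first.
- exact: leq_addr.
- by rewrite addnS ltnS leq_add2r.
have -> : \sum_(0 <= i < l) G i = 0.
  by rewrite big_nat big1 // => i /andP[_ lti]; rewrite /G bin_small // mul0n.
have -> : \sum_(l + n.+1 <= i < (m + n).+1) G i = 0.
  rewrite big_nat big1 // => i /andP[lti lti'].
  rewrite /G [X in (_ * X)%N]bin_small ?muln0 //; lia.
rewrite add0r addr0.
rewrite -{1}[l : nat]add0n big_addn addKn big_mkord; apply: eq_bigr => j _.
rewrite /G [(j + l)%N]addnC mulrnA scalerMnl -scalerMnr.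
have -> : (m + n - (l + j) = m - l + (n - j))%N by have := ltn_ord j; lia.
by [].
Qed.

(** * The series E(λ): differential equation and cocycle identity *)

Section Exponential.

Variables (K : numFieldType) (q : {poly K}).

Let E : nat -> {poly K}^o := pexp (qdiff q).

Lemma pexp0 : pexp (qdiff q) 0 = 1.
Proof. by rewrite /pexp big_ord1 expr0 coef1 invr1 scale1r. Qed.

Lemma qdiff_coefS (n : nat) : (qdiff q)`_n.+1 = q^`N(n.+1).
Proof.
have taylor_del i : ((q^:P)^:P)^`N(i).[del] = (q^`N(i))%:P.
  by rewrite !nderivn_map horner_map -[_.['X]]/(_ \Po 'X) comp_polyXr.
rewrite /qdiff coefB coefC subr0 addrC /comp_poly.
(* The bound is at least [n.+2] so that the index [n.+1] occurs in the sum even beyond the degree of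
   q. *)
rewrite (@nderiv_taylor_wide _ (maxn (size q) n.+2)); last 2 first.
- exact: mulrC.
- by rewrite !size_map_polyC leq_maxl.
rewrite coef_sum.
have ltn : (n.+1 < maxn (size q) n.+2)%N by rewrite leq_max leqnn orbT.
rewrite (bigD1 (Ordinal ltn)) //= big1 => [|i nei]; last first.
  rewrite taylor_del coefCM coefXn; case: eqP => [ni|_]; last by rewrite mulr0.
  by case/eqP: nei; apply: val_inj.
by rewrite addr0 taylor_del coefCM coefXn eqxx mulr1.
Qed.

(* E'(λ) = q'(λ+∂) E(λ) *)
Lemma pexp_ode (n : nat) :
  pexp (qdiff q) n.+1 *+ n.+1 = psmul (taylor q^`()) E n.
Proof.
have D'E j : (qdiff q)^`()`_j = q^`()^`N(j).
  rewrite coef_deriv qdiff_coefS; apply/polyP => i.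
  rewrite coefMn !coef_nderivn coef_deriv addSn -!mulrnA; congr (_ *+ _).
  by rewrite mulnC -mul_bin_diag.
rewrite /pexp big_ord_recl coef1 scaler0 add0r -sumrMnl.
(* Termwise, D^(k+1)/(k+1)! has λ-derivative D' D^k/k!. *)
transitivity (\sum_(k < n.+1) (k`!%:R^-1 : K) *: ((qdiff q)^`() * qdiff q ^+ k)`_n).
  apply: eq_bigr => k _; rewrite scalerMnr -coef_deriv deriv_exp coefMn /=.
  rewrite -scalerMnr scalerMnl; congr (_ *: _).
  by rewrite factS natrM invfM -mulr_natr mulrAC mulVf ?mul1r // pnatr_eq0.
transitivity (\sum_(i < n.+1) q^`()^`N(i) *
    \sum_(k < n.+1) (k`!%:R^-1 : K) *: (qdiff q ^+ k)`_(n - i)).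
  under eq_bigr do rewrite coefM scaler_sumr.
  rewrite exchange_big; apply: eq_bigr => i _ /=.
  by rewrite mulr_sumr; apply: eq_bigr => k _; rewrite D'E scalerAr.
apply: eq_bigr => i _; rewrite /E.
(* The truncation order of the exponential at degree [n - i] is raised to the uniform [n.+1]. *)
by rewrite (@pexp_stable _ q (n - i) n.+1) // ltnS leq_subr.
Qed.

(* Both sides solve dF/dμ = q'(λ+μ+∂) F with F = E(λ) at μ = 0: this is
   e^{q(λ+∂)-q(∂)} e^{q(λ+μ+∂)-q(λ+∂)} = e^{q(λ+μ+∂)-q(∂)}. *)
Lemma pexp_cocycle (n : nat) :
  psmul E (taylor (E n) : nat -> {poly K}^o) =1 (shift2 E)^~ n.
Proof.
elim/ltn_ind: n => -[|n] IHn m.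
  rewrite /shift2 addn0 binn mulr1n /psmul big_ord_recr /= subnn.
  rewrite /E pexp0 nderivn0 big1 ?add0r => [|i _]; first exact: mulr1.
  by rewrite -polyC1 nderivnC ifN ?scaler0 // subn_eq0 -ltnNge ltn_ord.
(* The differential equation determines only (n+1) E_(n+1), so both sides are compared after
   multiplication by n+1, injective in characteristic 0. *)
have mulSI : injective (fun x : {poly K} => x *+ n.+1).
  move=> x y /eqP; rewrite -subr_eq0 -mulrnBl -scaler_nat scaler_eq0 pnatr_eq0 /=.
  by rewrite subr_eq0 => /eqP.
apply: mulSI => /=.
transitivity (psmul E (taylor (E n.+1 *+ n.+1) : nat -> {poly K}^o) m).
  rewrite /psmul -sumrMnl; apply: eq_bigr => i _.
  by rewrite nderivnMn; apply/esym/mulrnAr.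
rewrite /E pexp_ode -/E.
transitivity (\sum_(j < n.+1) psmul (taylor (q^`()^`N(j)))
    ((shift2 E)^~ (n - j)%N : nat -> {poly K}^o) m).
  transitivity (\sum_(j < n.+1)
      psmul E (taylor (q^`()^`N(j) * E (n - j)%N) : nat -> {poly K}^o) m).
    by rewrite -psmul_sum; apply: (@eq_psmul K {poly K}^o) => // i; exact: linear_sum.
  apply: eq_bigr => j _.
  transitivity (psmul E (psmul (taylor (q^`()^`N(j)))
      (taylor (E (n - j)%N) : nat -> {poly K}^o)) m).
    by apply: (@eq_psmul K {poly K}^o) => // i; rewrite nderivnM.
  rewrite psmulCA; apply: (@eq_psmul K {poly K}^o) => // i.
  by apply: IHn; rewrite ltnS leq_subr.
transitivity (shift2 (psmul (taylor q^`()) E) m n).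
  rewrite shift2_psmul; apply: eq_bigr => j _.
  by apply: (@eq_psmul K {poly K}^o) => // i; apply: shift2_nderivn.
(* The differential equation is read backwards, now at degree n+m; the binomial factors agree by
   (n+1) C(n+m+1, n+1) = (n+m+1) C(n+m, n). *)
rewrite !(shift2C _ m) /shift2 -pexp_ode -/E -!mulrnA addSn; congr (_ *+ _).
by rewrite [RHS]mulnC -mul_bin_diag.
Qed.

End Exponential.

(** * The twisted action and its submodules *)

Section Twist.

Variables (K : numFieldType) (A : lmodType {poly K}).
Variables (br : A -> A -> {fsfun nat -> A with 0}).
Variables (V : lmodType {poly K}) (act : A -> V -> nat -> V) (q : {poly K}).

Lemma gen_conformal_module_twist :
  gen_conformal_module br act -> gen_conformal_module br (twist q act).
Proof.
case=> linl linr dell delr comm; split=> [c a a' v n|c a v v' n|a v n|a v n|].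
- by rewrite /twist -psmul_linear; apply: eq_psmul => // i; apply: linl.
- by rewrite /twist -psmul_linear; apply: eq_psmul => // i; apply: linr.
- by rewrite /twist /pmul psmulCA; apply: eq_psmul => // i; apply: dell.
- by rewrite /twist /pmul psmulCA; apply: eq_psmul => // i; apply: delr.
pose E := pexp (qdiff q).
have actsum (I : Type) (r : seq I) (F : I -> V) a m :
    act a (\sum_(i <- r) F i) m = \sum_(i <- r) act a (F i) m.
  have act0 : act a 0 m = 0.
    have := linr (-1) a 0 0 m; rewrite polyCN scaleN1r scaleN1r oppr0 addr0 addNr.
    exact.
  apply: (big_morph (fun v => act a v m) _ act0) => v w.
  by have := linr 1 a v w m; rewrite !scale1r.
(* Coefficients of E(λ) a_λ (E(μ) b_μ v) = E(λ+μ) a_λ (b_μ v). *)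
have twist2 a b v m n : twist q act a (twist q act b v n) m =
    \sum_(j < n.+1) psmul ((shift2 E)^~ j) (act a (act b v (n - j)%N)) m.
  rewrite /twist -/E.
  transitivity (\sum_(j < n.+1) psmul E (act a (E j *: act b v (n - j)%N)) m).
    by rewrite -psmul_sum; apply: eq_psmul => // i; apply: actsum.
  apply: eq_bigr => j _.
  transitivity (psmul E (psmul (taylor (E j)) (act a (act b v (n - j)%N))) m).
    by apply: eq_psmul => // i; apply: psmul_taylor.
  by rewrite psmulA; apply: eq_psmul => // i; apply: pexp_cocycle.
move=> a b v m n.
have -> : twist q act b (twist q act a v m) n =
    \sum_(j < n.+1) psmul ((shift2 E)^~ j) (fun i => act b (act a v i) (n - j)%N) m.
  rewrite twist2 /psmul exchange_big; apply: eq_bigr => j _; apply: eq_bigr => l _.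
  by rewrite shift2C.
rewrite twist2 -sumrB.
transitivity (\sum_(j < n.+1) psmul ((shift2 E)^~ j)
    (fun i => act_shift act (br a b) v i (n - j)%N) m).
  apply: eq_bigr => j _; rewrite /psmul -sumrB; apply: eq_bigr => l _.
  by rewrite -scalerBr comm.
(* Each (c_k)_{λ+μ} v acquires the factor E(λ+μ); exchanging the sums pulls it past λ^k and out of
   the sum over k. *)
rewrite /act_shift; under [RHS]eq_bigr do rewrite shift2_psmul.
rewrite [RHS]exchange_big; apply: eq_bigr => j _; rewrite /psmul /=.
under eq_bigr do rewrite scaler_sumr.
rewrite (exchange_triangle m (fun l k => shift2 E l j *:
  shift2 (act (br a b k) v) (m - l - k)%N (n - j)%N)).
by apply: eq_bigr => k _; apply: eq_bigr => l _; rewrite subnAC.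
Qed.

Lemma submodule_twist (W : set V) :
  submodule (twist q act) W <-> submodule act W.
Proof.
have Wcomb (n : nat) (c : 'I_n -> {poly K}) (F : 'I_n -> V) : W 0 ->
    (forall (p : {poly K}) v w, W v -> W w -> W (p *: v + w)) ->
    (forall i, W (F i)) -> W (\sum_i c i *: F i).
  by move=> W0 Wlin WF; apply: (big_rec W) => // i v _; apply: Wlin.
split=> -[W0 Wlin Wact]; split=> // a w n Ww; last first.
  by apply: (Wcomb _ _ _ W0 Wlin) => i; apply: Wact.
elim/ltn_ind: n => n IHn.
(* Since E_0 = 1, the twisted coefficient of degree n is the original one plus a K[∂]-combination of
   those of lower degree. *)
have -> : act a w n = -1 *: (\sum_(i < n) pexp (qdiff q) i.+1 *: act a w (n - i.+1)%N)
    + twist q act a w n.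
  by rewrite /twist /psmul big_ord_recl pexp0 scale1r subn0 scaleN1r addrCA addNr addr0.
apply: (Wlin); last exact: Wact.
apply: (Wcomb _ _ _ W0 Wlin) => i; apply: IHn.
by rewrite ltn_subrL (leq_trans _ (ltn_ord i)).
Qed.

End Twist.

Theorem proposition2p9 (R : realType) (A : lmodType {poly R[i]})
    (br : A -> A -> {fsfun nat -> A with 0})
    (hA : lie_conformal_algebra br)
    (V : lmodType {poly R[i]}) (act : A -> V -> nat -> V)
    (hV : gen_conformal_module br act) (q : {poly R[i]}) :
  gen_conformal_module br (twist q act) /\
  (irreducible (twist q act) <-> irreducible act).
Proof.
split; first exact: gen_conformal_module_twist.
by split=> -[V0 irrV]; split=> // W /submodule_twist/irrV.
Qed.
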